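(* Let $\mathcal{X}$ be a real or complex linear space and let $q \in [1,\infty)$. Then every $q$-norm $\|\cdot\| : \mathcal{X} \to [0,\infty)$ on $\mathcal{X}$ is a norm on $\mathcal{X}$ in the usual sense.
   Context: Definition. Let $\mathcal{X}$ be a real or complex linear space and $q \in [1,\infty)$. A mapping $\|\cdot\| : \mathcal{X} \to [0,\infty)$ is called a $q$-norm on $\mathcal{X}$ if it satisfies the following conditions: (1) $\|x\| = 0 \Leftrightarrow x = 0$; (2) $\|\lambda x\| = |\lambda|\,\|x\|$ for all $x \in \mathcal{X}$ and all scalars $\lambda$; (3) $\|x+y\|^{q} \leq 2^{q-1}\left(\|x\|^{q} + \|y\|^{q}\right)$ for all $x, y \in \mathcal{X}$. A norm in the usual sense is a mapping $\|\cdot\| : \mathcal{X} \to [0,\infty)$ satisfying (1), (2) and the triangle inequality $\|x+y\| \leq \|x\| + \|y\|$ for all $x,y \in \mathcal{X}$. *)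

(* Defs.v *)
From mathcomp Require Import all_boot all_order all_algebra.
From mathcomp Require Import reals exp.
From mathcomp Require Export complex.

Set Implicit Arguments.
Unset Strict Implicit.
Unset Printing Implicit Defensive.

Import GRing.Theory Num.Theory.
Local Open Scope ring_scope.

(* [modulus] is the real-valued absolute value on the scalars. It is a
   parameter because the library norm on [R[i]] takes its values in [R[i]],
   whereas [N] is real-valued. *)
Record is_qnorm (R : realType) (K : pzRingType) (modulus : K -> R)
    (X : lmodType K) (q : R) (N : X -> R) : Prop := IsQNorm {
  qnorm_ge0 : forall x, 0 <= N x ;
  qnorm_eq0 : forall x, N x = 0 <-> x = 0 ;
  qnormZ : forall (a : K) x, N (a *: x) = modulus a * N x ;
  qnormD : forall x y,
    N (x + y) `^ q <= 2 `^ (q - 1) * (N x `^ q + N y `^ q) }.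

Record is_norm (R : realType) (K : pzRingType) (modulus : K -> R)
    (X : lmodType K) (N : X -> R) : Prop := IsNorm {
  norm_ge0 : forall x, 0 <= N x ;
  norm_eq0 : forall x, N x = 0 <-> x = 0 ;
  normZ : forall (a : K) x, N (a *: x) = modulus a * N x ;
  normD : forall x y, N (x + y) <= N x + N y }.

Definition real_modulus (R : realType) (a : R) : R := `|a|.

Definition complex_modulus (R : realType) (a : R[i]) : R :=
  ComplexField.Normc.normc a.

(* Main.v *)
Require Import Defs.
From mathcomp Require Import all_boot all_order all_algebra.
From mathcomp Require Import reals exp complex.
From mathcomp Require Import classical_sets.
From mathcomp Require Import ring lra.

(** Condition (3) and homogeneity say that [N `^ q] is midpoint convex.  By
    homogeneity the triangle inequality reduces to the convexity of the unit
    ball: if [N u <= 1] and [N v <= 1] then [N (t u + (1 - t) v) <= 1] for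
    [0 <= t <= 1] ([qnorm_ball_convex]), since [x + y] is [N x + N y] times a
    convex combination of the unit vectors along [x] and [y].

    Write [g t] for [N (t u + (1 - t) v) `^ q].  A point of the segment in the
    half next to [v] is the midpoint of [v] and of another point of the segment,
    and similarly in the half next to [u].  As [g <= 1] at both ends, midpoint
    convexity bounds [g] by the average of [1] and of another of its values.
    Moreover [g] is bounded on the segment, by (3) again, so its supremum [S]
    there is finite and satisfies [S <= (S + 1) / 2], that is [S <= 1]
    ([le1_of_halving]).  Boundedness thus replaces the continuity that is usually
    invoked to pass from midpoint convexity to convexity.

    Only real scalars enter the argument; it is carried out once over a ring of
    scalars [K] that receives a morphism [iota] from [R] with
    [modulus (iota a) = `|a|], which covers both [R] and [R[i]]. *)

Import Order.TTheory GRing.Theory Num.Theory.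
Local Open Scope ring_scope.

(** The functional inequalities bound the supremum [S] of [g] on [[0, 1]] by
    [(S + 1) / 2]; finiteness of [S] is what makes this conclusive. *)
Lemma le1_of_halving (R : realType) (g : R -> R) (M : R) :
  (forall t, 0 <= t <= 1 -> g t <= M) ->
  (forall t, 0 <= t <= 2^-1 -> g t <= 2^-1 * (g (2 * t) + 1)) ->
  (forall t, 2^-1 <= t <= 1 -> g t <= 2^-1 * (g (2 * t - 1) + 1)) ->
  forall t, 0 <= t <= 1 -> g t <= 1.
Proof.
move=> gM gl gr.
pose E := [set g t | t in [set t : R | 0 <= t <= 1]]%classic.
have leE t : 0 <= t <= 1 -> g t <= sup E.
  move=> t01; apply: ub_le_sup; last by exists t.
  by exists M => _ [s s01 <-]; exact: gM.
suff supE : sup E <= 2^-1 * (sup E + 1).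
  by move=> t /leE gt; lra.
apply: ge_sup; first by exists (g 0); exists 0 => //=; rewrite lexx ler01.
move=> _ [t /= t01 <-]; have [t2|t2] := leP t 2^-1.
  have /gl gt : 0 <= t <= 2^-1 by lra.
  have /leE : 0 <= 2 * t <= 1 by lra.
  by lra.
have /gr gt : 2^-1 <= t <= 1 by lra.
have /leE : 0 <= 2 * t - 1 <= 1 by lra.
by lra.
Qed.

Section QNormIsNorm.
Context (R : realType) (K : pzRingType) (modulus : K -> R).
Context (iota : {rmorphism R -> K}).
Hypothesis modulus_iota : forall a, modulus (iota a) = `|a|.
Context (X : lmodType K) (q : R) (N : X -> R).
Hypotheses (q_ge1 : 1 <= q) (Nq : is_qnorm modulus q N).

Let q_gt0 : 0 < q. Proof. exact: lt_le_trans q_ge1. Qed.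

Let N_ge0 x : 0 <= N x. Proof. exact: (qnorm_ge0 Nq). Qed.

Lemma qnormZ_ge0 a x : 0 <= a -> N (iota a *: x) = a * N x.
Proof. by move=> a0; rewrite (qnormZ Nq) modulus_iota ger0_norm. Qed.

(** The constant in (3) is exactly the one that makes [N `^ q] midpoint convex:
    halving the argument contributes [2 `^ (- q)], and
    [2 `^ (- q) * 2 `^ (q - 1) = 2^-1]. *)
Lemma qnorm_powR_midpoint x y :
  N (iota 2^-1 *: (x + y)) `^ q <= 2^-1 * (N x `^ q + N y `^ q).
Proof.
rewrite qnormZ_ge0 ?invr_ge0// powRM ?invr_ge0//.
have -> : 2^-1 * (N x `^ q + N y `^ q)
    = (2^-1 : R) `^ q * (2 `^ (q - 1) * (N x `^ q + N y `^ q)).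
  rewrite mulrA; congr (_ * _).
  by rewrite -(@mulr_powRB1 _ 2^-1 q)// ?invr_ge0// -mulrA -powRM ?invr_ge0//
    mulVf ?pnatr_eq0// powR1 mulr1.
by apply: ler_wpM2l; [exact: powR_ge0 | exact: (qnormD Nq)].
Qed.

Lemma powR_le1 a : 0 <= a -> (a `^ q <= 1) = (a <= 1).
Proof.
move=> a0; apply/idP/idP => [|a1].
  by case: (leP a 1) => // a1; rewrite leNgt (lt_le_trans a1)// le1r_powR// ltW.
by have := ge0_ler_powR (ltW q_gt0) a0 ler01 a1; rewrite powR1.
Qed.

(** [le1_of_halving] applied to [N `^ q] along the segment from [v] (at [t = 0])
    to [u] (at [t = 1]): the point of parameter [t] is the midpoint of [v] and the
    point of parameter [2 t], and also of [u] and the point of parameter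
    [2 t - 1]. *)
Lemma qnorm_ball_convex u v t : N u <= 1 -> N v <= 1 -> 0 <= t <= 1 ->
  N (iota t *: u + iota (1 - t) *: v) <= 1.
Proof.
move=> u1 v1 t01; rewrite -powR_le1//; move: t t01.
have powu : N u `^ q <= 1 by rewrite powR_le1.
have powv : N v `^ q <= 1 by rewrite powR_le1.
(* The bound is what (3) gives when both summands have [N] at most 1. *)
apply: (@le1_of_halving _ _ (2 `^ (q - 1) * (1 + 1))) => t /andP[t0 t1].
- apply: le_trans (qnormD Nq _ _) _; apply: ler_wpM2l; first exact: powR_ge0.
  by apply: lerD; rewrite powR_le1// qnormZ_ge0 ?subr_ge0// mulr_ile1 ?subr_ge0//
    lerBlDr lerDl.
- have -> : iota t *: u + iota (1 - t) *: v =
      iota 2^-1 *: ((iota (2 * t) *: u + iota (1 - 2 * t) *: v) + v).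
    rewrite !scalerDr !scalerA -!rmorphM -addrA -scalerDl -rmorphD.
    by congr (iota _ *: _ + iota _ *: _); field.
  by apply: le_trans (qnorm_powR_midpoint _ _) _; rewrite ler_pM2l ?invr_gt0// lerD2l.
- have -> : iota t *: u + iota (1 - t) *: v =
      iota 2^-1 *: ((iota (2 * t - 1) *: u + iota (1 - (2 * t - 1)) *: v) + u).
    rewrite !scalerDr !scalerA -!rmorphM addrAC -scalerDl -rmorphD.
    by congr (iota _ *: _ + iota _ *: _); field.
  by apply: le_trans (qnorm_powR_midpoint _ _) _; rewrite ler_pM2l ?invr_gt0// lerD2l.
Qed.

(** With [s = N x + N y], the sum [x + y] is [s] times the convex combination of
    the normalised vectors [x / N x] and [y / N y] with weights [N x / s] and
    [N y / s], so it lies in the ball of radius [s]. *)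
Lemma qnorm_triangle x y : N (x + y) <= N x + N y.
Proof.
have [Nx0|Nx_neq0] := eqVneq (N x) 0.
  by rewrite Nx0 ((qnorm_eq0 Nq x).1 Nx0) !add0r.
have [Ny0|Ny_neq0] := eqVneq (N y) 0.
  by rewrite Ny0 ((qnorm_eq0 Nq y).1 Ny0) !addr0.
have Nx_gt0 : 0 < N x by rewrite lt0r Nx_neq0 N_ge0.
have Ny_gt0 : 0 < N y by rewrite lt0r Ny_neq0 N_ge0.
have s_gt0 : 0 < N x + N y by rewrite addr_gt0.
have s_neq0 := lt0r_neq0 s_gt0.
have unit z : N z != 0 -> N (iota (N z)^-1 *: z) <= 1.
  by move=> z0; rewrite qnormZ_ge0 ?invr_ge0// mulVf.
have -> : x + y = iota (N x + N y) *:
    (iota (N x / (N x + N y)) *: (iota (N x)^-1 *: x)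
     + iota (1 - N x / (N x + N y)) *: (iota (N y)^-1 *: y)).
  rewrite scalerDr !scalerA -!rmorphM.
  have -> : (N x + N y) * (N x / (N x + N y)) / N x = 1.
    by field; rewrite Nx_neq0.
  have -> : (N x + N y) * (1 - N x / (N x + N y)) / N y = 1.
    by field; rewrite Ny_neq0.
  by rewrite rmorph1 !scale1r.
rewrite qnormZ_ge0 ?(ltW s_gt0)// ler_piMr ?(ltW s_gt0)//.
apply: qnorm_ball_convex; rewrite ?unit//.
by rewrite divr_ge0 ?(ltW s_gt0)//= ler_pdivrMr// mul1r lerDl.
Qed.

Lemma qnorm_is_norm : is_norm modulus N.
Proof.
split; [exact: N_ge0 | exact: (qnorm_eq0 Nq) | exact: (qnormZ Nq) |].
exact: qnorm_triangle.
Qed.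

End QNormIsNorm.

Theorem theorem1p4 (R : realType) (q : R) (hq : 1 <= q) :
  (forall (X : lmodType R) (N : X -> R),
     is_qnorm (@real_modulus R) q N -> is_norm (@real_modulus R) N) /\
  (forall (X : lmodType R[i]) (N : X -> R),
     is_qnorm (@complex_modulus R) q N -> is_norm (@complex_modulus R) N).
Proof.
split=> X N Nq.
  exact: (@qnorm_is_norm R R _ idfun (fun=> erefl) X q N hq Nq).
apply: (@qnorm_is_norm R R[i] _ (real_complex R) _ X q N hq Nq) => a.
by rewrite /complex_modulus /= expr0n addr0 sqrtr_sqr.
Qed.
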